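(* Let $\mathbf C=(\mathbf C,\otimes,I)$ be a symmetric (strict) monoidal category with symmetry $\sigma$, coclosed relative to a full monoidal subcategory $\mathbf P\subset\mathbf C$, and let $\mathbb B=(X,\mu_X,\eta_X,\Delta_X,\varepsilon_X)$ be a bimonoid in $\mathbf C$. Then the category $\mathrm{Corep}_{\mathbf P}(\mathbb B)$ is equipped with a monoidal structure. The monoidal product on objects has the form $(V,\omega)\otimes(V',\omega')=(V\otimes V',\omega'')$, where $\omega''$ is the corepresentation $$\mathbf{coend}(V\otimes V')\xrightarrow{\varkappa}\mathbf{coend}(V)\otimes\mathbf{coend}(V')\xrightarrow{\omega\otimes\omega'}X\otimes X\xrightarrow{\mu_X}X.$$ On morphisms it is given by the monoidal product $\otimes$ of $\mathbf C$. The unit object of $\mathrm{Corep}_{\mathbf P}(\mathbb B)$ is $(I,\eta_X)$. If $\mathbb B$ is commutative (i.e. $\mu_X\cdot\sigma_{X,X}=\mu_X$), then the monoidal category $\mathrm{Corep}_{\mathbf P}(\mathbb B)$ is symmetric with $\sigma_{(V,\omega),(V',\omega')}=\sigma_{V,V'}$.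
   Context: Monoidal categories are strict; $f\cdot g$ denotes composition ($g$ first). $\mathbf C$ is coclosed relative to $\mathbf P$ if there are a bifunctor $\mathbf{cohom}\colon\mathbf P^{op}\times\mathbf P\to\mathbf C$ and bijections $\vartheta_{W,V,Z}\colon\mathrm{Hom}(\mathbf{cohom}(V,W),Z)\to\mathrm{Hom}(W,Z\otimes V)$ natural in $V,W\in\mathbf P$, $Z\in\mathbf C$. Put $\mathrm{coev}_{V,W}=\vartheta(\mathrm{id})\colon W\to\mathbf{cohom}(V,W)\otimes V$. For $V\in\mathbf P$, $\mathbf{coend}(V)=\mathbf{cohom}(V,V)$ is a comonoid with comultiplication $d_V=\vartheta^{-1}\big((\mathrm{id}\otimes\mathrm{coev}_{V,V})\cdot\mathrm{coev}_{V,V}\big)$ and counit $v_V=\vartheta^{-1}(\mathrm{id}_V)$. The isomorphism $\mathrm{coev}_{I,I}\colon I\to\mathbf{coend}(I)\otimes I=\mathbf{coend}(I)$ identifies the comonoid $\mathbf{coend}(I)$ with the unit comonoid $(I,\mathrm{id}_I,\mathrm{id}_I)$, so that $\eta_X\colon\mathbf{coend}(I)=I\to X$. The morphism $\varkappa\colon\mathbf{cohom}(V\otimes V',W\otimes W')\to\mathbf{cohom}(V,W)\otimes\mathbf{cohom}(V',W')$ is $\varkappa=\vartheta^{-1}\big(\sigma^{(23)}\cdot(\mathrm{coev}_{V,W}\otimes\mathrm{coev}_{V',W'})\big)$, where $\sigma^{(23)}\colon\mathbf{cohom}(V,W)\otimes V\otimes\mathbf{cohom}(V',W')\otimes V'\to\mathbf{cohom}(V,W)\otimes\mathbf{cohom}(V',W')\otimes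 V\otimes V'$ swaps the 2nd and 3rd factors by the symmetry. A bimonoid is an object with monoid and comonoid structures such that comultiplication and counit are morphisms of monoids. $\mathrm{Corep}_{\mathbf P}(\mathbb B)$ is the category of corepresentations of the underlying comonoid $\mathbb O=(X,\Delta_X,\varepsilon_X)$: objects are pairs $(V,\omega)$ with $V\in\mathbf P$ and $\omega\colon\mathbf{coend}(V)\to\mathbb O$ a morphism of comonoids; morphisms $(V,\omega)\to(W,\nu)$ are morphisms $f\colon V\to W$ in $\mathbf P$ with $\omega\cdot\mathbf{cohom}(f,\mathrm{id}_V)=\nu\cdot\mathbf{cohom}(\mathrm{id}_W,f)$ as morphisms $\mathbf{cohom}(W,V)\to X$. *)

(* Defs.v *)
From Stdlib Require Import ssreflect ProofIrrelevance.

Set Implicit Arguments.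
Unset Strict Implicit.
Unset Printing Implicit Defensive.

Declare Scope cat_scope.
Delimit Scope cat_scope with cat.
Local Open Scope cat_scope.

Record category := Category {
  obj :> Type;
  hom : obj -> obj -> Type;
  idm : forall A, hom A A;
  comp : forall A B D, hom B D -> hom A B -> hom A D;
  comp_idl : forall A B (f : hom A B), comp (idm B) f = f;
  comp_idr : forall A B (f : hom A B), comp f (idm A) = f;
  compA : forall A B D E (h : hom D E) (g : hom B D) (f : hom A B),
    comp h (comp g f) = comp (comp h g) f
}.

Arguments idm {c} A.

(* [f · g] applies [g] first. *)
Notation "f · g" := (comp f g) (at level 40, left associativity) : cat_scope.

Record functor (C D : category) := Functor {
  fob :> C -> D;
  fmap : forall A B, hom A B -> hom (fob A) (fob B);
  fmap_id : forall A, fmap (idm A) = idm (fob A);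
  fmap_comp : forall A B E (f : hom B E) (g : hom A B),
    fmap (f · g) = fmap f · fmap g
}.

Definition opcat (C : category) : category :=
  @Category C (fun A B => @hom C B A) (fun A => idm A)
    (fun A B D f g => @comp C D B A g f)
    (fun A B f => comp_idr f) (fun A B f => comp_idl f)
    (fun A B D E h g f => eq_sym (compA f g h)).

Definition prodcat (C D : category) : category.
Proof.
refine (@Category (C * D)%type
  (fun A B => (hom (fst A) (fst B) * hom (snd A) (snd B))%type)
  (fun A => (idm (fst A), idm (snd A)))
  (fun A B E f g => (fst f · fst g, snd f · snd g)) _ _ _).
- by move=> A B [f g] /=; rewrite !comp_idl.
- by move=> A B [f g] /=; rewrite !comp_idr.
- by move=> A B E F [h h'] [g g'] [f f'] /=; rewrite !compA.
Defined.

Record iso (C : category) (A B : C) := Iso {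
  iso_hom : hom A B;
  iso_inv : hom B A;
  iso_homK : iso_inv · iso_hom = idm A;
  iso_invK : iso_hom · iso_inv = idm B
}.

(* The identity, seen as a morphism between objects that are only
   propositionally equal. *)
Definition eqhom (C : category) (A B : C) (e : A = B) : hom A B :=
  match e in _ = B' return hom A B' with eq_refl => idm A end.

Record monoidal_data (C : category) := MonoidalData {
  tens0 : C -> C -> C;
  tens1 : forall A B A' B',
    hom A B -> hom A' B' -> hom (tens0 A A') (tens0 B B');
  unit0 : C
}.

(* Strictness: the associativity and unit isomorphisms are identities, i.e.
   the objects are equal and the morphisms agree modulo [eqhom]. *)
Record is_strict_monoidal (C : category) (M : monoidal_data C) : Prop := {
  tens1_id : forall A B,
    tens1 M (idm A) (idm B) = idm (tens0 M A B);
  tens1_comp : forall A B D A' B' D' (f : hom B D) (g : hom A B)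
      (f' : hom B' D') (g' : hom A' B'),
    tens1 M (f · g) (f' · g') = tens1 M f f' · tens1 M g g';
  tens0A : forall A B D,
    tens0 M (tens0 M A B) D = tens0 M A (tens0 M B D);
  tens0_unitl : forall A, tens0 M (unit0 M) A = A;
  tens0_unitr : forall A, tens0 M A (unit0 M) = A;
  tens1A : forall A B D A' B' D'
      (f : hom A A') (g : hom B B') (h : hom D D'),
    eqhom (tens0A A' B' D') · tens1 M (tens1 M f g) h
    = tens1 M f (tens1 M g h) · eqhom (tens0A A B D);
  tens1_unitl : forall A A' (f : hom A A'),
    eqhom (tens0_unitl A') · tens1 M (idm (unit0 M)) f
    = f · eqhom (tens0_unitl A);
  tens1_unitr : forall A A' (f : hom A A'),
    eqhom (tens0_unitr A') · tens1 M f (idm (unit0 M))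
    = f · eqhom (tens0_unitr A)
}.

Record moncat := MonCat {
  moncat_cat :> category;
  moncat_data : monoidal_data moncat_cat;
  moncat_laws : is_strict_monoidal moncat_data
}.

Definition tens (M : moncat) (A B : M) : M := tens0 (moncat_data M) A B.
Definition tensm (M : moncat) (A B A' B' : M) (f : hom A B) (f' : hom A' B') :
  hom (tens A A') (tens B B') := tens1 (moncat_data M) f f'.
Definition munit (M : moncat) : M := unit0 (moncat_data M).

Notation "A ⊗ B" := (tens A B) (at level 38, left associativity) : cat_scope.
Notation "f ⊠ g" := (tensm f g) (at level 38, left associativity) : cat_scope.

(* The identifications [(A ⊗ B) ⊗ D = A ⊗ (B ⊗ D)], [I ⊗ A = A] and
   [A ⊗ I = A] as morphisms, in both directions. *)
Definition assoc (M : moncat) (A B D : M) : hom (A ⊗ B ⊗ D) (A ⊗ (B ⊗ D)) :=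
  eqhom (tens0A (moncat_laws M) A B D).
Definition unassoc (M : moncat) (A B D : M) : hom (A ⊗ (B ⊗ D)) (A ⊗ B ⊗ D) :=
  eqhom (eq_sym (tens0A (moncat_laws M) A B D)).
Definition lunit (M : moncat) (A : M) : hom (munit M ⊗ A) A :=
  eqhom (tens0_unitl (moncat_laws M) A).
Definition unlunit (M : moncat) (A : M) : hom A (munit M ⊗ A) :=
  eqhom (eq_sym (tens0_unitl (moncat_laws M) A)).
Definition runit (M : moncat) (A : M) : hom (A ⊗ munit M) A :=
  eqhom (tens0_unitr (moncat_laws M) A).

(* The second hexagon and the compatibility with the unit object follow. *)
Record is_symmetry (M : moncat) (s : forall A B : M, hom (A ⊗ B) (B ⊗ A)) :
    Prop := {
  sym_nat : forall A B A' B' (f : hom A B) (f' : hom A' B'),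
    s B B' · (f ⊠ f') = (f' ⊠ f) · s A A';
  sym_invol : forall A B, s B A · s A B = idm (A ⊗ B);
  sym_hexagon : forall A B D,
    assoc B D A · s A (B ⊗ D) · assoc A B D
    = (idm B ⊠ s A D) · assoc B A D · (s A B ⊠ idm D)
}.

Record symmoncat := SymMonCat {
  symmoncat_mon :> moncat;
  sym : forall A B : symmoncat_mon, hom (A ⊗ B) (B ⊗ A);
  symP : is_symmetry sym
}.

Arguments sym {s} A B.

Definition sym23 (C : symmoncat) (A B D E : C) :
    hom (A ⊗ B ⊗ (D ⊗ E)) (A ⊗ D ⊗ (B ⊗ E)) :=
  unassoc A D (B ⊗ E) · (idm A ⊠ assoc D B E) · (idm A ⊠ (sym B D ⊠ idm E))
  · (idm A ⊠ unassoc B D E) · assoc A B (D ⊗ E).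

Record monoid_data (M : moncat) := MonoidData {
  mon_obj :> M;
  mu : hom (mon_obj ⊗ mon_obj) mon_obj;
  eta : hom (munit M) mon_obj
}.

Record is_monoid (M : moncat) (X : monoid_data M) : Prop := {
  muA : mu X · (mu X ⊠ idm X) = mu X · (idm X ⊠ mu X) · assoc X X X;
  mu_etal : mu X · (eta X ⊠ idm X) = lunit X;
  mu_etar : mu X · (idm X ⊠ eta X) = runit X
}.

Record comonoid_data (M : moncat) := ComonoidData {
  com_obj :> M;
  delta : hom com_obj (com_obj ⊗ com_obj);
  eps : hom com_obj (munit M)
}.

Record is_comonoid (M : moncat) (X : comonoid_data M) : Prop := {
  deltaA : assoc X X X · (delta X ⊠ idm X) · delta X
           = (idm X ⊠ delta X) · delta X;
  delta_epsl : lunit X · (eps X ⊠ idm X) · delta X = idm X;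
  delta_epsr : runit X · (idm X ⊠ eps X) · delta X = idm X
}.

Definition is_monoid_mor (M : moncat) (X Y : monoid_data M) (f : hom X Y) :
    Prop :=
  f · mu X = mu Y · (f ⊠ f) /\ f · eta X = eta Y.

Definition is_comonoid_mor (M : moncat) (X Y : comonoid_data M)
    (f : hom X Y) : Prop :=
  delta Y · f = (f ⊠ f) · delta X /\ eps Y · f = eps X.

Definition unit_monoid (M : moncat) : monoid_data M :=
  @MonoidData M (munit M) (lunit (munit M)) (idm (munit M)).

Definition unit_comonoid (M : moncat) : comonoid_data M :=
  @ComonoidData M (munit M) (unlunit (munit M)) (idm (munit M)).

Definition tens_monoid (C : symmoncat) (X Y : monoid_data C) : monoid_data C :=
  @MonoidData C (X ⊗ Y) ((mu X ⊠ mu Y) · sym23 X Y X Y)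
    ((eta X ⊠ eta Y) · unlunit (munit C)).

Record bimonoid (C : symmoncat) := Bimonoid {
  bim_obj :> C;
  bim_mu : hom (bim_obj ⊗ bim_obj) bim_obj;
  bim_eta : hom (munit C) bim_obj;
  bim_delta : hom bim_obj (bim_obj ⊗ bim_obj);
  bim_eps : hom bim_obj (munit C);
  bim_mon := MonoidData bim_mu bim_eta;
  bim_com := ComonoidData bim_delta bim_eps;
  bim_monP : is_monoid bim_mon;
  bim_comP : is_comonoid bim_com;
  bim_deltaP : @is_monoid_mor C bim_mon (tens_monoid bim_mon bim_mon) bim_delta;
  bim_epsP : @is_monoid_mor C bim_mon (unit_monoid C) bim_eps
}.

Definition commutative (C : symmoncat) (X : bimonoid C) : Prop :=
  bim_mu X · sym X X = bim_mu X.

Record full_monsub (M : moncat) := FullMonSub {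
  in_sub :> M -> Prop;
  in_sub_unit : in_sub (munit M);
  in_sub_tens : forall A B, in_sub A -> in_sub B -> in_sub (A ⊗ B)
}.

Record subobj (M : moncat) (P : full_monsub M) := SubObj {
  sub_val :> M;
  sub_in : P sub_val
}.

Definition fullsub (M : moncat) (P : full_monsub M) : category :=
  @Category (subobj P) (fun V W => @hom M V W)
    (fun V => idm (sub_val V)) (fun V W U f g => @comp M V W U f g)
    (fun V W f => comp_idl f) (fun V W f => comp_idr f)
    (fun V W U T h g f => compA h g f).

Definition sub_unit (M : moncat) (P : full_monsub M) : subobj P :=
  SubObj (in_sub_unit P).
Definition sub_tens (M : moncat) (P : full_monsub M) (V W : subobj P) :
  subobj P := SubObj (in_sub_tens (sub_in V) (sub_in W)).

Arguments sub_unit {M} P.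

Definition cohom_ob (M : moncat) (P : full_monsub M)
    (F : functor (prodcat (opcat (fullsub P)) (fullsub P)) M)
    (V W : subobj P) : M := F (V, W).

Definition cohom_map (M : moncat) (P : full_monsub M)
    (F : functor (prodcat (opcat (fullsub P)) (fullsub P)) M)
    (V V' W W' : subobj P) (f : @hom M V V') (g : @hom M W W') :
    hom (cohom_ob F V' W) (cohom_ob F V W') :=
  @fmap _ _ F (V', W) (V, W') (f, g).

Record coclosed (M : moncat) (P : full_monsub M) := Coclosed {
  cohomF : functor (prodcat (opcat (fullsub P)) (fullsub P)) M;
  theta : forall (W V : subobj P) (Z : M),
    hom (cohom_ob cohomF V W) Z -> hom W (Z ⊗ V);
  theta_inv : forall (W V : subobj P) (Z : M),
    hom W (Z ⊗ V) -> hom (cohom_ob cohomF V W) Z;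
  thetaK : forall W V Z (t : hom (cohom_ob cohomF V W) Z),
    theta_inv (theta t) = t;
  theta_invK : forall (W V : subobj P) Z (t : hom W (Z ⊗ V)),
    theta (theta_inv t) = t;
  theta_nat : forall (V V' W W' : subobj P) (Z Z' : M)
      (f : @hom M V V') (g : @hom M W' W) (h : hom Z Z')
      (t : hom (cohom_ob cohomF V W) Z),
    @theta W' V' Z' (h · t · cohom_map cohomF f g) = (h ⊠ f) · theta t · g
}.

Definition cohom (M : moncat) (P : full_monsub M) (H : coclosed P)
  (V W : subobj P) : M := cohom_ob (cohomF H) V W.

Definition cohomm (M : moncat) (P : full_monsub M) (H : coclosed P)
    (V V' W W' : subobj P) (f : @hom M V V') (g : @hom M W W') :
  hom (cohom H V' W) (cohom H V W') := cohom_map (cohomF H) f g.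

Definition coev (M : moncat) (P : full_monsub M) (H : coclosed P)
  (V W : subobj P) : hom W (cohom H V W ⊗ V) := theta (idm (cohom H V W)).

Definition coend (M : moncat) (P : full_monsub M) (H : coclosed P)
    (V : subobj P) : comonoid_data M :=
  @ComonoidData M (cohom H V V)
    (@theta_inv M P H V V _
      (unassoc _ _ V · (idm (cohom H V V) ⊠ coev H V V) · coev H V V))
    (@theta_inv M P H V V _ (unlunit V)).

Lemma eqhom_trans (C : category) (A B D : C) (e : A = B) (e' : B = D) :
  eqhom e' · eqhom e = eqhom (eq_trans e e').
Proof. by case: D / e'; rewrite comp_idl. Qed.

Lemma eqhom_irr (C : category) (A B : C) (e e' : A = B) : eqhom e = eqhom e'.
Proof. by rewrite (proof_irrelevance _ e e'). Qed.

Lemma eqhom_id (C : category) (A : C) (e : A = A) : eqhom e = idm A.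
Proof. exact: (eqhom_irr e eq_refl). Qed.

Lemma tensm_id (M : moncat) (A B : M) : idm A ⊠ idm B = idm (A ⊗ B).
Proof. exact: (tens1_id (moncat_laws M)). Qed.

Lemma tensm_comp (M : moncat) (A B D A' B' D' : M) (f : hom B D) (g : hom A B)
    (f' : hom B' D') (g' : hom A' B') :
  (f · g) ⊠ (f' · g') = (f ⊠ f') · (g ⊠ g').
Proof. exact: (tens1_comp (moncat_laws M)). Qed.

Lemma eqhom_tensl (M : moncat) (A A' B : M) (e : A = A') :
  eqhom e ⊠ idm B = eqhom (f_equal (fun Z => Z ⊗ B) e).
Proof. by case: A' / e; rewrite tensm_id. Qed.

Lemma eqhom_tensr (M : moncat) (A A' B : M) (e : A = A') :
  idm B ⊠ eqhom e = eqhom (f_equal (fun Z => B ⊗ Z) e).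
Proof. by case: A' / e; rewrite tensm_id. Qed.

Lemma assocK (M : moncat) (A B D : M) : unassoc A B D · assoc A B D = idm _.
Proof. by rewrite /assoc /unassoc eqhom_trans eqhom_id. Qed.

Lemma unassocK (M : moncat) (A B D : M) : assoc A B D · unassoc A B D = idm _.
Proof. by rewrite /assoc /unassoc eqhom_trans eqhom_id. Qed.

Lemma assoc_nat (M : moncat) (A B D A' B' D' : M)
    (f : hom A A') (g : hom B B') (h : hom D D') :
  assoc A' B' D' · (f ⊠ g ⊠ h) = (f ⊠ (g ⊠ h)) · assoc A B D.
Proof. exact: (tens1A (moncat_laws M)). Qed.

Lemma unassoc_nat (M : moncat) (A B D A' B' D' : M)
    (f : hom A A') (g : hom B B') (h : hom D D') :
  (f ⊠ g ⊠ h) · unassoc A B D = unassoc A' B' D' · (f ⊠ (g ⊠ h)).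
Proof.
rewrite -[LHS]comp_idl -(assocK A' B' D') -!compA.
by congr (_ · _); rewrite compA assoc_nat -compA unassocK comp_idr.
Qed.

Lemma lunit_nat (M : moncat) (A A' : M) (f : hom A A') :
  lunit A' · (idm (munit M) ⊠ f) = f · lunit A.
Proof. exact: (tens1_unitl (moncat_laws M)). Qed.

Lemma runit_nat (M : moncat) (A A' : M) (f : hom A A') :
  runit A' · (f ⊠ idm (munit M)) = f · runit A.
Proof. exact: (tens1_unitr (moncat_laws M)). Qed.

Lemma unlunit_nat (M : moncat) (A A' : M) (f : hom A A') :
  (idm (munit M) ⊠ f) · unlunit A = unlunit A' · f.
Proof.
have K (B : M) : unlunit B · lunit B = idm _.
  by rewrite /lunit /unlunit eqhom_trans eqhom_id.
have K' (B : M) : lunit B · unlunit B = idm _.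
  by rewrite /lunit /unlunit eqhom_trans eqhom_id.
rewrite -[LHS]comp_idl -K -!compA; congr (_ · _).
by rewrite compA lunit_nat -compA K' comp_idr.
Qed.

Lemma tensm_compl (M : moncat) (A B D E : M) (f : hom B D) (g : hom A B) :
  (f · g) ⊠ idm E = (f ⊠ idm E) · (g ⊠ idm E).
Proof. by rewrite -tensm_comp comp_idl. Qed.

Lemma tensm_compr (M : moncat) (A B D E : M) (f : hom B D) (g : hom A B) :
  idm E ⊠ (f · g) = (idm E ⊠ f) · (idm E ⊠ g).
Proof. by rewrite -tensm_comp comp_idl. Qed.

Lemma tensm_rl (M : moncat) (A B A' B' : M) (f : hom A B) (f' : hom A' B') :
  f ⊠ f' = (idm B ⊠ f') · (f ⊠ idm A').
Proof. by rewrite -tensm_comp comp_idl comp_idr. Qed.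

Lemma tensm_lr (M : moncat) (A B A' B' : M) (f : hom A B) (f' : hom A' B') :
  f ⊠ f' = (f ⊠ idm B') · (idm A ⊠ f').
Proof. by rewrite -tensm_comp comp_idl comp_idr. Qed.

Lemma pentagon (M : moncat) (A B D E : M) :
  (assoc A B D ⊠ idm E) · unassoc (A ⊗ B) D E · unassoc A B (D ⊗ E)
  = unassoc A (B ⊗ D) E · (idm A ⊠ unassoc B D E).
Proof.
by rewrite /assoc /unassoc eqhom_tensl eqhom_tensr !eqhom_trans; apply: eqhom_irr.
Qed.

Lemma triangle_l (M : moncat) (A B : M) :
  (lunit A ⊠ idm B) · unassoc (munit M) A B · unlunit (A ⊗ B) = idm (A ⊗ B).
Proof.
by rewrite /lunit /unassoc /unlunit eqhom_tensl !eqhom_trans eqhom_id.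
Qed.

Lemma triangle_r (M : moncat) (A B : M) :
  (runit A ⊠ idm B) · unassoc A (munit M) B · (idm A ⊠ unlunit B)
  = idm (A ⊗ B).
Proof.
by rewrite /runit /unassoc /unlunit eqhom_tensl eqhom_tensr !eqhom_trans eqhom_id.
Qed.

Lemma theta_inj (M : moncat) (P : full_monsub M) (H : coclosed P)
    (V W : subobj P) (Z : M) (s t : hom (cohom H V W) Z) :
  theta s = theta t -> s = t.
Proof. by move=> e; rewrite -(thetaK s) -(thetaK t) e. Qed.

Lemma thetaE (M : moncat) (P : full_monsub M) (H : coclosed P)
    (V W : subobj P) (Z : M) (t : hom (cohom H V W) Z) :
  theta t = (t ⊠ idm (sub_val V)) · coev H V W.
Proof.
have := theta_nat (idm (sub_val V)) (idm (sub_val W)) t (idm (cohom H V W)).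
have -> : cohom_map (cohomF H) (idm (sub_val V)) (idm (sub_val W)) = idm _.
  exact: (@fmap_id _ _ (cohomF H) (V, W)).
by rewrite !comp_idr => ->.
Qed.

Lemma theta_comp (M : moncat) (P : full_monsub M) (H : coclosed P)
    (V W : subobj P) (Z Z' : M) (h : hom Z Z') (t : hom (cohom H V W) Z) :
  theta (h · t) = (h ⊠ idm (sub_val V)) · theta t.
Proof. by rewrite !thetaE tensm_compl compA. Qed.

Lemma theta_id (M : moncat) (P : full_monsub M) (H : coclosed P)
    (V W : subobj P) : theta (idm (cohom H V W)) = coev H V W.
Proof. by []. Qed.

Lemma theta_coend_delta (M : moncat) (P : full_monsub M) (H : coclosed P)
    (V : subobj P) :
  @theta M P H V V _ (delta (coend H V))
  = unassoc _ _ _ · (idm (cohom H V V) ⊠ coev H V V) · coev H V V.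
Proof. exact: theta_invK. Qed.

Lemma theta_coend_eps (M : moncat) (P : full_monsub M) (H : coclosed P)
    (V : subobj P) : @theta M P H V V _ (eps (coend H V)) = unlunit V.
Proof. exact: theta_invK. Qed.

Lemma theta_tens_delta (M : moncat) (P : full_monsub M) (H : coclosed P)
    (V : subobj P) (Z Z' : M) (f : hom (cohom H V V) Z)
    (g : hom (cohom H V V) Z') :
  @theta M P H V V _ ((f ⊠ g) · delta (coend H V))
  = unassoc Z Z' V · (f ⊠ theta g) · coev H V V.
Proof.
rewrite theta_comp theta_coend_delta !compA unassoc_nat.
by rewrite -(compA _ _ (_ ⊠ coev H V V)) -tensm_comp comp_idr -thetaE.
Qed.

Lemma coend_comonoid (M : moncat) (P : full_monsub M) (H : coclosed P)
    (V : subobj P) : is_comonoid (coend H V).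
Proof.
split; rewrite -compA; apply: (@theta_inj M P H V V).
- rewrite theta_comp !theta_tens_delta theta_id [_ ⊠ coev _ _ _]tensm_rl.
  rewrite -!compA; change (com_obj (coend H V)) with (cohom H V V).
  rewrite -thetaE theta_coend_delta !tensm_compr !compA.
  congr (_ · _ · _); rewrite -pentagon -!compA -unassoc_nat tensm_id.
  by rewrite !compA.
- rewrite theta_comp theta_tens_delta theta_id [_ ⊠ coev _ _ _]tensm_rl.
  rewrite -!compA; change (com_obj (coend H V)) with (cohom H V V).
  rewrite -thetaE theta_coend_eps unlunit_nat !compA.
  by rewrite triangle_l comp_idl.
- rewrite theta_comp theta_tens_delta theta_coend_eps !compA.
  by rewrite triangle_r comp_idl.
Qed.

(* [coev_{I,I}] followed by the identification [coend I ⊗ I = coend I]. *)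
Definition coev_unit (M : moncat) (P : full_monsub M) (H : coclosed P) :
    hom (munit M) (coend H (sub_unit P)) :=
  runit _ · coev H (sub_unit P) (sub_unit P).

Lemma coev_unitK (M : moncat) (P : full_monsub M) (H : coclosed P) :
  eps (coend H (sub_unit P)) · coev_unit H = idm (munit M).
Proof.
rewrite /coev_unit compA -runit_nat -compA.
rewrite -(thetaE (eps (coend H (sub_unit P)))) theta_coend_eps.
by rewrite /runit /unlunit eqhom_trans eqhom_id.
Qed.

Lemma coev_unit_invK (M : moncat) (P : full_monsub M) (H : coclosed P) :
  coev_unit H · eps (coend H (sub_unit P)) = idm (cohom H _ _).
Proof.
apply: (@theta_inj M P H (sub_unit P) (sub_unit P)).
rewrite theta_comp theta_coend_eps theta_id.
set E := cohom H (sub_unit P) (sub_unit P).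
have rI (f g : hom (munit M) (E ⊗ munit M)) :
    runit E · f = runit E · g -> f = g.
  move=> e; rewrite -[f]comp_idl -[g]comp_idl.
  have <- : eqhom (eq_sym (tens0_unitr (moncat_laws M) E)) · runit E = idm _.
    by rewrite /runit eqhom_trans eqhom_id.
  by rewrite -!compA e.
apply: rI; rewrite compA runit_nat -compA.
by rewrite /runit /unlunit eqhom_trans eqhom_id comp_idr.
Qed.

Definition coend_unit_iso (M : moncat) (P : full_monsub M) (H : coclosed P) :
    iso (munit M) (coend H (sub_unit P)) :=
  Iso (coev_unitK H) (coev_unit_invK H).

Lemma coev_unit_comonoid_mor (M : moncat) (P : full_monsub M)
    (H : coclosed P) :
  @is_comonoid_mor M (unit_comonoid M) (coend H (sub_unit P)) (coev_unit H).
Proof.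
split; last exact: coev_unitK.
set d := delta (coend H (sub_unit P)); set v := eps (coend H (sub_unit P)).
have vd : (v ⊠ v) · d = unlunit (munit M) · v.
  apply: (@theta_inj M P H (sub_unit P) (sub_unit P)).
  rewrite theta_tens_delta theta_comp !theta_coend_eps tensm_rl -!compA.
  rewrite -thetaE theta_coend_eps /unassoc /unlunit eqhom_tensl eqhom_tensr.
  by rewrite !eqhom_trans; apply: eqhom_irr.
have -> : d = (coev_unit H ⊠ coev_unit H) · unlunit (munit M) · v.
  by rewrite -compA -vd compA -tensm_comp !coev_unit_invK tensm_id comp_idl.
by rewrite -compA coev_unitK comp_idr.
Qed.

Record corep (C : symmoncat) (P : full_monsub C) (H : coclosed P)
    (X : bimonoid C) := Corep {
  corep_val :> subobj P;
  corep_mor : hom (coend H corep_val) (bim_com X);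
  corep_morP : is_comonoid_mor corep_mor
}.

Definition is_corep_mor (C : symmoncat) (P : full_monsub C) (H : coclosed P)
    (X : bimonoid C) (a b : corep H X) (f : @hom C a b) : Prop :=
  corep_mor a · cohomm H f (idm (sub_val a))
  = corep_mor b · cohomm H (idm (sub_val b)) f.

Record corep_hom (C : symmoncat) (P : full_monsub C) (H : coclosed P)
    (X : bimonoid C) (a b : corep H X) := CorepHom {
  corep_hom_val :> @hom C a b;
  corep_homP : is_corep_mor corep_hom_val
}.

Lemma corep_hom_eq (C : symmoncat) (P : full_monsub C) (H : coclosed P)
    (X : bimonoid C) (a b : corep H X) (f g : corep_hom a b) :
  corep_hom_val f = corep_hom_val g -> f = g.
Proof.
case: f g => [f fP] [g gP] /= e; case: g / e gP => gP.
by rewrite (proof_irrelevance _ fP gP).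
Qed.

Lemma cohomm_comp (M : moncat) (P : full_monsub M) (H : coclosed P)
    (V V' V'' W W' W'' : subobj P) (f : @hom M V' V'') (f' : @hom M V V')
    (g : @hom M W' W'') (g' : @hom M W W') :
  cohomm H (f · f') (g · g') = cohomm H f' g · cohomm H f g'.
Proof.
exact: (@fmap_comp _ _ (cohomF H) (V'', W) (V', W') (V, W'') (f', g) (f, g')).
Qed.

Lemma corep_mor_id (C : symmoncat) (P : full_monsub C) (H : coclosed P)
    (X : bimonoid C) (a : corep H X) :
  @is_corep_mor C P H X a a (idm (sub_val a)).
Proof. by []. Qed.

Lemma corep_mor_comp (C : symmoncat) (P : full_monsub C) (H : coclosed P)
    (X : bimonoid C) (a b c : corep H X) (f : @hom C b c) (g : @hom C a b) :
  is_corep_mor f -> is_corep_mor g -> @is_corep_mor C P H X a c (f · g).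
Proof.
rewrite /is_corep_mor => fP gP.
have split (V V' W W' : subobj P) (h : @hom C V V') (k : @hom C W W') :
    cohomm H h (idm (sub_val W')) · cohomm H (idm (sub_val V')) k
    = cohomm H (idm (sub_val V)) k · cohomm H h (idm (sub_val W)).
  by rewrite -!cohomm_comp !comp_idl !comp_idr.
rewrite -{1}[idm (sub_val a)]comp_idl -[idm (sub_val c)]comp_idl !cohomm_comp.
by rewrite !compA gP -fP -!compA split.
Qed.

Definition Corep_cat (C : symmoncat) (P : full_monsub C) (H : coclosed P)
    (X : bimonoid C) : category.
Proof.
refine (@Category (corep H X) (@corep_hom C P H X)
  (fun a => CorepHom (@corep_mor_id C P H X a))
  (fun a b c f g => CorepHom (corep_mor_comp (corep_homP f) (corep_homP g)))
  _ _ _).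
- by move=> a b f; apply/corep_hom_eq/comp_idl.
- by move=> a b f; apply/corep_hom_eq/comp_idr.
- by move=> a b c d h g f; apply/corep_hom_eq/compA.
Defined.

Definition kappa (C : symmoncat) (P : full_monsub C) (H : coclosed P)
    (V V' W W' : subobj P) :
    hom (cohom H (sub_tens V V') (sub_tens W W'))
        (cohom H V W ⊗ cohom H V' W') :=
  @theta_inv C P H (sub_tens W W') (sub_tens V V') _
    (sym23 (cohom H V W) V (cohom H V' W') V'
     · (coev H V W ⊠ coev H V' W')).

Definition corep_tens_mor (C : symmoncat) (P : full_monsub C) (H : coclosed P)
    (X : bimonoid C) (a b : corep H X) :
    hom (coend H (sub_tens a b)) (bim_com X) :=
  bim_mu X · (corep_mor a ⊠ corep_mor b) · kappa H a b a b.

(* [eta_X : coend I = I -> X]. *)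
Definition corep_unit_mor (C : symmoncat) (P : full_monsub C) (H : coclosed P)
    (X : bimonoid C) : hom (coend H (sub_unit P)) (bim_com X) :=
  bim_eta X · iso_inv (coend_unit_iso H).

Definition corep_tens (C : symmoncat) (P : full_monsub C) (H : coclosed P)
    (X : bimonoid C)
    (tensP : forall a b : corep H X, is_comonoid_mor (corep_tens_mor a b))
    (a b : corep H X) : corep H X :=
  @Corep C P H X (sub_tens a b) (corep_tens_mor a b) (tensP a b).

(* Every piece of data is determined by its underlying data in [C]; the
   arguments are the proofs that these data are well defined in [Corep_cat]. *)
Definition corep_monoidal_data (C : symmoncat) (P : full_monsub C)
    (H : coclosed P) (X : bimonoid C)
    (tensP : forall a b : corep H X, is_comonoid_mor (corep_tens_mor a b))
    (unitP : is_comonoid_mor (corep_unit_mor H X))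
    (tensmP : forall (a b a' b' : corep H X) (f : corep_hom a b)
                (f' : corep_hom a' b'),
       @is_corep_mor C P H X (corep_tens tensP a a') (corep_tens tensP b b')
         (f ⊠ f')) :
    monoidal_data (Corep_cat H X) :=
  @MonoidalData (Corep_cat H X) (corep_tens tensP)
    (fun a b a' b' f f' => CorepHom (tensmP a b a' b' f f'))
    (@Corep C P H X (sub_unit P) (corep_unit_mor H X) unitP).

Arguments corep_monoidal_data {C P H X} tensP unitP tensmP.

Definition corep_sym (C : symmoncat) (P : full_monsub C)
    (H : coclosed P) (X : bimonoid C)
    (tensP : forall a b : corep H X, is_comonoid_mor (corep_tens_mor a b))
    (unitP : is_comonoid_mor (corep_unit_mor H X))
    (tensmP : forall (a b a' b' : corep H X) (f : corep_hom a b)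
                (f' : corep_hom a' b'),
       @is_corep_mor C P H X (corep_tens tensP a a') (corep_tens tensP b b')
         (f ⊠ f'))
    (monP : is_strict_monoidal (corep_monoidal_data tensP unitP tensmP))
    (symP : forall a b : corep H X,
       @is_corep_mor C P H X (corep_tens tensP a b) (corep_tens tensP b a)
         (sym (sub_val a) (sub_val b))) :
    forall a b : MonCat monP, hom (a ⊗ b) (b ⊗ a) :=
  fun a b => CorepHom (symP a b).

Arguments corep_sym {C P H X tensP unitP tensmP} monP symP.

(* Main.v *)
From Stdlib Require Import ssreflect ProofIrrelevance.
Require Import Defs.

(** By the adjunction [theta], a morphism [w : coend V -> X] is the same thing
    as a morphism [r : V -> X ⊗ V]; [w] is a morphism of comonoids exactly
    when [r] is a coassociative and counital coaction
    ([comonoid_mor_comodule]), and a morphism of [P] is a morphism of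
    corepresentations exactly when it commutes with the coactions
    ([corep_mor_coaction]). So the claim is about comodules over the bimonoid
    [X]. Under [theta] the product of corepresentations becomes

      [V ⊗ V' -> X ⊗ V ⊗ X ⊗ V' -> X ⊗ X ⊗ V ⊗ V' -> X ⊗ V ⊗ V']

    (coactions, symmetry, multiplication), and the unit becomes [eta ⊠ id_I]
    ([theta_corep_tens_mor], [theta_corep_unit_mor]).

    That these are again comodules follows from the compatibility of [delta]
    and [eps] with [mu] and [eta], together with the naturality of [sym23] and
    its coherence properties [sym23_assoc_in] and [heq_sym23_unit_in]. That
    the product is strictly associative and unital follows from the monoid
    axioms and from [sym23_assoc_out], [heq_sym23_unitl] and
    [heq_sym23_unitr]: both sides of each law have the same underlying object,
    and a corepresentation is determined by its underlying object and its
    coaction ([corep_ext]). When [mu] is commutative, [sym23_sym] shows that the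
    symmetry of [C] commutes with the coactions. All remaining axioms are
    equations between morphisms of [C], where they hold already.

    Strict associativity is an equality of objects, hence the two sides of a
    coherence equation often have propositionally equal but different types.
    They are compared by the relation [f ≡ g], equality up to composition with
    [eqhom]. Modulo this relation, every morphism built from the symmetry is
    brought into a form that acts on right-bracketed products through
    [sw A B Z : A ⊗ (B ⊗ Z) -> B ⊗ (A ⊗ Z)]; in that form the coherence laws
    reduce to the hexagons, the naturality and the involutivity of [sw]. *)

Local Open Scope cat_scope.

Section CorepMonoidal.

Set Implicit Arguments.
Unset Strict Implicit.
Unset Printing Implicit Defensive.

(** * Equality of morphisms up to equality of objects *)

(** Two morphisms whose sources and targets are propositionally equal agree
    after transport along these equalities. By proof irrelevance the choice of
    the equalities is immaterial. *)
Definition heq (C : category) (A B A' B' : C) (f : hom A B) (g : hom A' B') :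
    Prop :=
  exists (e : A = A') (e' : B = B'), eqhom e' · f = g · eqhom e.

Notation "f ≡ g" := (heq f g) (at level 70, no associativity) : cat_scope.

Lemma heq_eq (C : category) (A B : C) (f g : hom A B) : f ≡ g -> f = g.
Proof. by move=> [e [e']]; rewrite !eqhom_id comp_idl comp_idr. Qed.

Lemma heq_refl (C : category) (A B : C) (f : hom A B) : f ≡ f.
Proof. by exists eq_refl, eq_refl; rewrite /= comp_idl comp_idr. Qed.

Lemma eq_heq (C : category) (A B : C) (f g : hom A B) : f = g -> f ≡ g.
Proof. by move=> ->; apply: heq_refl. Qed.

Lemma heq_sym (C : category) (A B A' B' : C) (f : hom A B) (g : hom A' B') :
  f ≡ g -> g ≡ f.
Proof.
move=> [e [e']]; case: A' / e g => g; case: B' / e' g => g /=.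
by rewrite comp_idl comp_idr => ->; apply: heq_refl.
Qed.

Lemma heq_trans (C : category) (A B A' B' A'' B'' : C) (g : hom A' B')
    (f : hom A B) (h : hom A'' B'') : f ≡ g -> g ≡ h -> f ≡ h.
Proof.
move=> [e [e']]; case: A' / e g => g; case: B' / e' g => g /=.
by rewrite comp_idl comp_idr => ->.
Qed.

Lemma heq_comp (C : category) (A B D A' B' D' : C)
    (f : hom B D) (g : hom A B) (f' : hom B' D') (g' : hom A' B') :
  f ≡ f' -> g ≡ g' -> f · g ≡ f' · g'.
Proof.
move=> [e1 [e1' E1]] [e2 [e2' E2]]; exists e2, e1'.
by rewrite compA E1 -compA (eqhom_irr e1 e2') E2 compA.
Qed.

Lemma heq_idm (C : category) (A B : C) : A = B -> idm A ≡ idm B.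
Proof. by move=> ->; apply: heq_refl. Qed.

Lemma heq_eqhom (C : category) (A B : C) (e : A = B) : eqhom e ≡ idm B.
Proof. by case: B / e; apply: heq_refl. Qed.

Lemma heq_eqhom_dom (C : category) (A B : C) (e : A = B) : eqhom e ≡ idm A.
Proof. by case: B / e; apply: heq_refl. Qed.

Lemma heq_eqhoml (C : category) (A B B' A1 B1 : C) (f : hom A B) (e : B = B')
    (g : hom A1 B1) : f ≡ g -> eqhom e · f ≡ g.
Proof. by case: B' / e; rewrite comp_idl. Qed.

Lemma heq_eqhomr (C : category) (A B A' A1 B1 : C) (f : hom A B) (e : A' = A)
    (g : hom A1 B1) : f ≡ g -> f · eqhom e ≡ g.
Proof. by case: A / e f => f; rewrite comp_idr. Qed.

(** A morphism that is an identity up to transport is itself a transport. *)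
Lemma heq_id_eqhom (C : category) (A B D : C) (i : hom A B) :
  i ≡ idm D -> exists e : A = B, i = eqhom e.
Proof.
move=> [e [e' E]]; exists (eq_trans e (eq_sym e')); rewrite -eqhom_trans.
rewrite -(comp_idl (eqhom e)) -E compA eqhom_trans eqhom_id.
by rewrite comp_idl.
Qed.

Lemma heq_idl (C : category) (A B D E A' B' : C) (f : hom A B) (i : hom B D)
  (g : hom A' B') : i ≡ idm E -> f ≡ g -> i · f ≡ g.
Proof. by move=> /heq_id_eqhom[e ->]; apply: heq_eqhoml. Qed.

Lemma heq_idr (C : category) (A B D E A' B' : C) (f : hom A B) (i : hom D A)
  (g : hom A' B') : i ≡ idm E -> f ≡ g -> f · i ≡ g.
Proof. by move=> /heq_id_eqhom[e ->]; apply: heq_eqhomr. Qed.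

(** Inverses of equivalent morphisms are equivalent. *)
Lemma heq_inv (C : category) (A B A' B' : C) (f : hom A B) (f' : hom B A)
    (g : hom A' B') (g' : hom B' A') :
  f ≡ g -> f · f' = idm B -> g' · g = idm A' -> f' ≡ g'.
Proof.
move=> [e [e' E]] ff' g'g; exists e', e.
rewrite -[eqhom e]comp_idl -g'g -[g' · g · _]compA -E -!compA ff'.
by rewrite comp_idr.
Qed.

Section Monoidal.

Variable M : moncat.
Implicit Types A B D : M.

Lemma heq_tens A B A' B' A1 B1 A1' B1'
    (f : hom A B) (f' : hom A' B') (g : hom A1 B1) (g' : hom A1' B1') :
  f ≡ g -> f' ≡ g' -> f ⊠ f' ≡ g ⊠ g'.
Proof.
move=> [e [e' E]] [e1 [e1' E1]].
case: A1 / e g E => g; case: B1 / e' g => g /=.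
case: A1' / e1 g' E1 => g'; case: B1' / e1' g' => g' /=.
by rewrite !comp_idl !comp_idr => -> ->; apply: heq_refl.
Qed.

Lemma heq_tensl A B A1 B1 D (f : hom A B) (g : hom A1 B1) :
  f ≡ g -> f ⊠ idm D ≡ g ⊠ idm D.
Proof. by move=> fg; apply: heq_tens fg (heq_refl _). Qed.

Lemma heq_tensr A B A1 B1 D (f : hom A B) (g : hom A1 B1) :
  f ≡ g -> idm D ⊠ f ≡ idm D ⊠ g.
Proof. exact: heq_tens (heq_refl _). Qed.

Lemma heq_tens_id A B A' B' D D' (f : hom A B) (f' : hom A' B') :
  f ≡ idm D -> f' ≡ idm D' -> f ⊠ f' ≡ idm (D ⊗ D').
Proof. by rewrite -tensm_id; apply: heq_tens. Qed.

Lemma heq_tensA A B D A' B' D' (f : hom A A') (g : hom B B') (h : hom D D') :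
  f ⊠ g ⊠ h ≡ f ⊠ (g ⊠ h).
Proof.
exists (tens0A (moncat_laws M) _ _ _), (tens0A (moncat_laws M) _ _ _).
exact: assoc_nat.
Qed.

Lemma heq_unitl A A' (f : hom A A') : idm (munit M) ⊠ f ≡ f.
Proof.
exists (tens0_unitl (moncat_laws M) _), (tens0_unitl (moncat_laws M) _).
exact: lunit_nat.
Qed.

Lemma heq_unitr A A' (f : hom A A') : f ⊠ idm (munit M) ≡ f.
Proof.
exists (tens0_unitr (moncat_laws M) _), (tens0_unitr (moncat_laws M) _).
exact: runit_nat.
Qed.

Lemma heq_idA A B D D' (f : hom D D') :
  idm (A ⊗ B) ⊠ f ≡ idm A ⊠ (idm B ⊠ f).
Proof. by rewrite -tensm_id; apply: heq_tensA. Qed.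

Lemma heq_Aid A B D D' (f : hom D D') :
  f ⊠ idm A ⊠ idm B ≡ f ⊠ idm (A ⊗ B).
Proof. by rewrite -tensm_id; apply: heq_tensA. Qed.

End Monoidal.

(** * Coherence of the symmetry *)

Section Symmetric.

Variable C : symmoncat.
Implicit Types A B D E Z : C.

(** The exchange of the two leading factors of a right-bracketed product. *)
Definition sw A B Z : hom (A ⊗ (B ⊗ Z)) (B ⊗ (A ⊗ Z)) :=
  assoc B A Z · (sym A B ⊠ idm Z) · unassoc A B Z.

Lemma sw_nat A B Z A' B' Z' (f : hom A A') (g : hom B B') (h : hom Z Z') :
  sw A' B' Z' · (f ⊠ (g ⊠ h)) = (g ⊠ (f ⊠ h)) · sw A B Z.
Proof.
rewrite /sw -!compA -unassoc_nat (compA (sym _ _ ⊠ _)) -tensm_comp.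
rewrite (sym_nat (symP C)) comp_idl !compA -assoc_nat -!compA; congr (_ · _).
by rewrite compA -tensm_comp comp_idr.
Qed.

Lemma sw_invol A B Z : sw B A Z · sw A B Z = idm (A ⊗ (B ⊗ Z)).
Proof.
rewrite /sw -!compA (compA (unassoc _ _ _)) assocK comp_idl.
rewrite (compA (sym _ _ ⊠ _)) -tensm_comp (sym_invol (symP C)) comp_idl.
by rewrite tensm_id comp_idl unassocK.
Qed.

Lemma sym23E A B D E :
  sym23 A B D E = unassoc A D (B ⊗ E) · (idm A ⊠ sw B D E) · assoc A B (D ⊗ E).
Proof. by rewrite /sym23 /sw !tensm_compr !compA. Qed.

Lemma sym23_nat A B D E A' B' D' E'
    (f : hom A A') (g : hom B B') (h : hom D D') (k : hom E E') :
  sym23 A' B' D' E' · (f ⊠ g ⊠ (h ⊠ k)) = (f ⊠ h ⊠ (g ⊠ k)) · sym23 A B D E.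
Proof.
rewrite !sym23E -!compA assoc_nat (compA (idm _ ⊠ sw _ _ _)) -tensm_comp.
by rewrite sw_nat comp_idl -{1}[f]comp_idr tensm_comp !compA unassoc_nat.
Qed.

Lemma sym23_natl A B D E A' D' (f : hom A A') (h : hom D D') :
  sym23 A' B D' E · (f ⊠ idm B ⊠ (h ⊠ idm E))
  = (f ⊠ h ⊠ idm (B ⊗ E)) · sym23 A B D E.
Proof. by rewrite sym23_nat tensm_id. Qed.

Lemma sym23_natr A B D E B' E' (g : hom B B') (k : hom E E') :
  sym23 A B' D E' · (idm A ⊠ g ⊠ (idm D ⊠ k))
  = (idm (A ⊗ D) ⊠ (g ⊠ k)) · sym23 A B D E.
Proof. by rewrite sym23_nat tensm_id. Qed.

Lemma heq_sym23 A B D E : sym23 A B D E ≡ idm A ⊠ sw B D E.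
Proof. by rewrite sym23E; apply/heq_eqhomr/heq_eqhoml/heq_refl. Qed.

Lemma heq_sw A B Z : sw A B Z ≡ sym A B ⊠ idm Z.
Proof. by apply/heq_eqhomr/heq_eqhoml/heq_refl. Qed.

Lemma heq_sw_tens A B Z Z' : sw A B Z ⊠ idm Z' ≡ sw A B (Z ⊗ Z').
Proof.
apply: heq_trans (heq_tensl _ (heq_sw A B Z)) _.
apply: heq_trans (heq_Aid _ _ _) _.
exact/heq_sym/heq_sw.
Qed.

Lemma heq_sym_tensr A B D :
  sym A (B ⊗ D) ≡ (idm B ⊠ sym A D) · sw A B D.
Proof.
apply: (@heq_trans _ _ _ _ _ _ _
  (assoc B D A · sym A (B ⊗ D) · assoc A B D)).
  exact/heq_sym/heq_eqhomr/heq_eqhoml/heq_refl.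
rewrite (sym_hexagon (symP C)) -compA; apply: heq_comp (heq_refl _) _.
apply: heq_eqhoml; exact/heq_sym/heq_sw.
Qed.

Lemma heq_sym_tensl A B D :
  sym (A ⊗ B) D ≡ sw A D B · (idm A ⊠ sym B D).
Proof.
apply: heq_inv (heq_sym_tensr D A B) (sym_invol (symP C) _ _) _.
rewrite -compA (compA (idm A ⊠ _)) -tensm_comp (sym_invol (symP C)).
by rewrite comp_idl tensm_id comp_idl sw_invol.
Qed.

Lemma heq_sw_tensr A B D Z :
  sw A (B ⊗ D) Z ≡ (idm B ⊠ sw A D Z) · sw A B (D ⊗ Z).
Proof.
apply: heq_trans (heq_sw _ _ _) _.
apply: heq_trans (heq_tensl _ (heq_sym_tensr A B D)) _.
rewrite tensm_compl; apply: heq_comp (heq_sw_tens _ _ _ _).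
apply: heq_trans (heq_tensA _ _ _) _.
exact/heq_tensr/heq_sym/heq_sw.
Qed.

Lemma heq_sw_tensl A B D Z :
  sw (A ⊗ B) D Z ≡ sw A D (B ⊗ Z) · (idm A ⊠ sw B D Z).
Proof.
apply: heq_inv (heq_sw_tensr D A B Z) (sw_invol _ _ _) _.
rewrite -compA (compA (idm A ⊠ _)) -tensm_comp sw_invol.
by rewrite comp_idl tensm_id comp_idl sw_invol.
Qed.

(** The hexagon at [A], [I], [I] makes the symmetry, seen as an endomorphism
    of [A ⊗ I], idempotent; being invertible, it is the identity. *)
Lemma heq_sym_unitr A : sym A (munit C) ≡ idm A.
Proof.
set s := sym A (munit C).
have eI : munit C ⊗ munit C = munit C := tens0_unitl (moncat_laws C) _.
have eA : munit C ⊗ A = A ⊗ munit C.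
  rewrite [LHS](tens0_unitl (moncat_laws C)).
  by rewrite [RHS](tens0_unitr (moncat_laws C)).
pose t := eqhom eA · s.
have st : s ≡ t by apply/heq_sym/heq_eqhoml/heq_refl.
have congs B B' : B = B' -> sym A B ≡ sym A B'.
  by move=> ->; apply: heq_refl.
have tt : t · t = t.
  apply: heq_eq; apply: heq_sym.
  apply: heq_trans (heq_sym st) _.
  apply: heq_trans (congs _ _ (eq_sym eI)) _.
  apply: heq_trans (heq_sym_tensr _ _ _) _.
  apply: heq_comp; first exact: heq_trans (heq_unitl _) st.
  apply: heq_trans (heq_sw _ _ _) _.
  exact: heq_trans (heq_unitr _) st.
have t1 : t = idm _.
  rewrite -[t]comp_idl.
  have K : sym (munit C) A · eqhom (eq_sym eA) · t = idm _.
    rewrite /t -compA (compA (eqhom _)) eqhom_trans eqhom_id comp_idl.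
    exact: (sym_invol (symP C)).
  by rewrite -{1}K -compA tt K.
apply: heq_trans st _; rewrite t1 -tensm_id; exact: heq_unitr.
Qed.

Lemma heq_sym_unitl A : sym (munit C) A ≡ idm A.
Proof.
apply: heq_inv (heq_sym_unitr A) (sym_invol (symP C) _ _) _.
exact: comp_idl.
Qed.

Lemma heq_sw_unitr A Z : sw A (munit C) Z ≡ idm (A ⊗ Z).
Proof.
apply: heq_trans (heq_sw _ _ _) _; rewrite -tensm_id.
exact/heq_tensl/heq_sym_unitr.
Qed.

Lemma heq_sw_unitl A Z : sw (munit C) A Z ≡ idm (A ⊗ Z).
Proof.
apply: heq_trans (heq_sw _ _ _) _; rewrite -tensm_id.
exact/heq_tensl/heq_sym_unitl.
Qed.

(** [sym23] turns [⊗] into a monoidal functor of two variables: regrouping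
    two columns of three factors by rows does not depend on the order in which
    the rows are split off. *)
Lemma sym23_assoc_in A B D A' B' D' :
  (sym23 A B A' B' ⊠ idm (D ⊗ D')) · sym23 (A ⊗ B) D (A' ⊗ B') D'
  ≡ (idm (A ⊗ A') ⊠ sym23 B D B' D') · sym23 A (B ⊗ D) A' (B' ⊗ D').
Proof.
set K := idm A ⊠ sw B A' (B' ⊗ (D ⊗ D'))
  · (idm A ⊠ (idm B ⊠ ((idm A' ⊠ sw D B' D') · sw D A' (B' ⊗ D')))).
apply: (@heq_trans _ _ _ _ _ _ _ K).
  apply: heq_comp.
    apply: heq_trans (heq_tensl _ (heq_sym23 _ _ _ _)) _.
    apply: heq_trans (heq_tensA _ _ _) _.
    exact/heq_tensr/heq_sw_tens.
  apply: heq_trans (heq_sym23 _ _ _ _) _.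
  apply: heq_trans (heq_idA _ _ _) _.
  exact/heq_tensr/heq_tensr/heq_sw_tensr.
apply: heq_sym.
apply: (@heq_trans _ _ _ _ _ _ _
  ((idm A ⊠ (idm A' ⊠ (idm B ⊠ sw D B' D')))
   · (idm A ⊠ (sw B A' (D ⊗ (B' ⊗ D')) · (idm B ⊠ sw D A' (B' ⊗ D')))))).
  apply: heq_comp.
    apply: heq_trans (heq_idA _ _ _) _.
    exact/heq_tensr/heq_tensr/heq_sym23.
  apply: heq_trans (heq_sym23 _ _ _ _) _.
  exact/heq_tensr/heq_sw_tensl.
apply: eq_heq; rewrite /K -!tensm_compr compA -sw_nat.
by rewrite -compA -tensm_compr.
Qed.

(** The previous lemma as an equality of morphisms of one type. *)
Lemma sym23_unassoc A B D A' B' D' :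
  (sym23 A B A' B' ⊠ idm (D ⊗ D')) · sym23 (A ⊗ B) D (A' ⊗ B') D'
    · (unassoc A B D ⊠ unassoc A' B' D')
  = unassoc (A ⊗ A') (B ⊗ B') (D ⊗ D') · (idm (A ⊗ A') ⊠ sym23 B D B' D')
    · sym23 A (B ⊗ D) A' (B' ⊗ D').
Proof.
apply: heq_eq; rewrite -(compA (unassoc _ _ _)).
apply: heq_trans (heq_sym (heq_eqhoml _ (heq_refl _))).
apply: heq_idr; last exact: sym23_assoc_in.
exact: heq_tens_id (heq_eqhom _) (heq_eqhom _).
Qed.

(** Regrouping three columns of two factors does not depend on the order in
    which the columns are merged. *)
Lemma sym23_assoc_out A B D A' B' D' :
  sym23 (A ⊗ B) (A' ⊗ B') D D' · (sym23 A A' B B' ⊠ idm (D ⊗ D'))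
  ≡ sym23 A A' (B ⊗ D) (B' ⊗ D') · (idm (A ⊗ A') ⊠ sym23 B B' D D').
Proof.
apply: (@heq_trans _ _ _ _ _ _ _
  ((idm A ⊠ (idm B ⊠ (sw A' D (B' ⊗ D') · (idm A' ⊠ sw B' D D'))))
   · (idm A ⊠ sw A' B (B' ⊗ (D ⊗ D'))))).
  apply: heq_comp.
    apply: heq_trans (heq_sym23 _ _ _ _) _.
    apply: heq_trans (heq_idA _ _ _) _.
    exact/heq_tensr/heq_tensr/heq_sw_tensl.
  apply: heq_trans (heq_tensl _ (heq_sym23 _ _ _ _)) _.
  apply: heq_trans (heq_tensA _ _ _) _.
  exact/heq_tensr/heq_sw_tens.
apply: heq_sym.
apply: (@heq_trans _ _ _ _ _ _ _
  ((idm A ⊠ ((idm B ⊠ sw A' D (B' ⊗ D')) · sw A' B (D ⊗ (B' ⊗ D'))))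
   · (idm A ⊠ (idm A' ⊠ (idm B ⊠ sw B' D D'))))).
  apply: heq_comp.
    apply: heq_trans (heq_sym23 _ _ _ _) _.
    exact/heq_tensr/heq_sw_tensr.
  apply: heq_trans (heq_idA _ _ _) _.
  exact/heq_tensr/heq_tensr/heq_sym23.
apply: eq_heq; rewrite -!tensm_compr -compA sw_nat.
by rewrite compA -tensm_compr.
Qed.

(** Regrouping two columns commutes with exchanging them. *)
Lemma sym23_sym A B D E :
  sym23 D E A B · sym (A ⊗ B) (D ⊗ E) = (sym A D ⊠ sym B E) · sym23 A B D E.
Proof.
apply: heq_eq.
apply: (@heq_trans _ _ _ _ _ _ _
  ((idm D ⊠ sw E A B) · (((idm D ⊠ sw A E B) · sw A D (E ⊗ B))
    · (idm A ⊠ ((idm D ⊠ sym B E) · sw B D E))))).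
  apply: heq_comp; first exact: heq_sym23.
  apply: heq_trans (heq_sym_tensl _ _ _) _.
  apply: heq_comp (heq_sw_tensr _ _ _ _) _.
  exact/heq_tensr/heq_sym_tensr.
rewrite 2!(compA (idm D ⊠ _)) -tensm_compr sw_invol tensm_id comp_idl.
rewrite tensm_compr (compA (sw A D _)) sw_nat.
apply: heq_comp; last exact/heq_sym/heq_sym23.
apply: (@heq_trans _ _ _ _ _ _ _
  ((idm (D ⊗ A) ⊠ sym B E) · (sym A D ⊠ idm (B ⊗ E)))).
  by apply: heq_comp (heq_sym (heq_idA _ _ _)) (heq_sw _ _ _).
by apply: eq_heq; rewrite -tensm_rl.
Qed.

Lemma heq_sym23_unit_in A B : sym23 (munit C) A (munit C) B ≡ idm (A ⊗ B).
Proof.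
apply: heq_trans (heq_sym23 _ _ _ _) _.
exact: heq_trans (heq_unitl _) (heq_sw_unitr _ _).
Qed.

Lemma heq_sym23_unitl A B : sym23 (munit C) (munit C) A B ≡ idm (A ⊗ B).
Proof.
apply: heq_trans (heq_sym23 _ _ _ _) _.
exact: heq_trans (heq_unitl _) (heq_sw_unitl _ _).
Qed.

Lemma heq_sym23_unitr A B : sym23 A B (munit C) (munit C) ≡ idm (A ⊗ B).
Proof.
apply: heq_trans (heq_sym23 _ _ _ _) _; rewrite -tensm_id.
apply: heq_tensr; apply: heq_trans (heq_sw_unitr _ _) _.
by rewrite -tensm_id; apply: heq_unitr.
Qed.

(** * Comodules over a bimonoid *)

(** [r] is a coassociative and counital left coaction of [X] on [V]. *)
Definition is_comodule (X : comonoid_data C) (V : C) (r : hom V (X ⊗ V)) :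
    Prop :=
  (delta X ⊠ idm V) · r = unassoc X X V · (idm X ⊠ r) · r
  /\ (eps X ⊠ idm V) · r = unlunit V.

(** The diagonal coaction on a tensor product: coact on both factors, bring
    the two copies of [X] together and multiply them. *)
Definition tens_coact (X : monoid_data C) (V V' : C) (r : hom V (X ⊗ V))
    (r' : hom V' (X ⊗ V')) : hom (V ⊗ V') (X ⊗ (V ⊗ V')) :=
  (mu X ⊠ idm (V ⊗ V')) · (sym23 X V X V' · (r ⊠ r')).

(** The trivial coaction on the unit object. *)
Definition unit_coact (X : monoid_data C) : hom (munit C) (X ⊗ munit C) :=
  (eta X ⊠ idm (munit C)) · unlunit (munit C).

(** Coassociativity of the diagonal coaction needs only that [d] and [m] are
    compatible, not the axioms of a monoid or of a comonoid. *)
Lemma tens_coact_coassoc (X V V' : C) (d : hom X (X ⊗ X)) (m : hom (X ⊗ X) X)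
    (r : hom V (X ⊗ V)) (r' : hom V' (X ⊗ V'))
    (R := (m ⊠ idm (V ⊗ V')) · (sym23 X V X V' · (r ⊠ r'))) :
  d · m = (m ⊠ m) · sym23 X X X X · (d ⊠ d) ->
  (d ⊠ idm V) · r = unassoc X X V · (idm X ⊠ r) · r ->
  (d ⊠ idm V') · r' = unassoc X X V' · (idm X ⊠ r') · r' ->
  (d ⊠ idm (V ⊗ V')) · R = unassoc X X (V ⊗ V') · (idm X ⊠ R) · R.
Proof.
move=> dm dr dr'; rewrite /R.
rewrite (compA (d ⊠ _)) -tensm_compl dm.
rewrite (tensm_compl _ (m ⊠ m · _)) (tensm_compl _ (m ⊠ m)).
rewrite -(compA _ (d ⊠ d ⊠ _)) (compA (d ⊠ d ⊠ _)) -sym23_natl.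
rewrite -(compA (sym23 _ V _ V')) -(tensm_comp (d ⊠ _)) dr dr'.
rewrite -!(compA (unassoc _ _ _)).
rewrite (tensm_comp (unassoc _ _ _)) (tensm_comp (idm X ⊠ r)).
rewrite -(compA (m ⊠ m ⊠ _)) (compA (sym23 _ V _ V')).
rewrite (compA (sym23 _ _ _ _ ⊠ _)) (compA (sym23 _ _ _ _ ⊠ _)).
rewrite sym23_unassoc -(compA _ (sym23 X (X ⊗ V) _ _)).
rewrite (compA (sym23 X (X ⊗ V) _ _)) sym23_natr.
rewrite -(compA _ (sym23 X V X V') (r ⊠ r')).
(* [q] is the diagonal coaction before multiplication; both sides become
   [unassoc · (m ⊠ (m ⊠ id)) · (id ⊠ q) · q]. *)
set q := sym23 X V X V' · (r ⊠ r').
rewrite -(compA (unassoc _ _ _)) (compA (idm (X ⊗ X) ⊠ sym23 _ _ _ _)).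
rewrite -tensm_compr -/q (compA (m ⊠ m ⊠ _)) unassoc_nat -compA.
congr (_ · _); rewrite 2!compA; congr (_ · _).
by rewrite -!tensm_comp comp_idl !comp_idr.
Qed.

Lemma tens_coact_counit (X V V' : C) (c : hom X (munit C)) (m : hom (X ⊗ X) X)
    (r : hom V (X ⊗ V)) (r' : hom V' (X ⊗ V')) :
  c · m = lunit (munit C) · (c ⊠ c) ->
  (c ⊠ idm V) · r = unlunit V -> (c ⊠ idm V') · r' = unlunit V' ->
  (c ⊠ idm (V ⊗ V')) · ((m ⊠ idm (V ⊗ V')) · (sym23 X V X V' · (r ⊠ r')))
  = unlunit (V ⊗ V').
Proof.
move=> cm cr cr'; rewrite compA -tensm_compl cm tensm_compl.
rewrite -compA (compA (c ⊠ c ⊠ _)) -sym23_natl -(compA (sym23 _ _ _ _)).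
rewrite -(tensm_comp (c ⊠ _)) cr cr'.
apply: heq_eq; apply: heq_trans (heq_sym (heq_eqhom_dom _)).
apply: heq_idl.
  exact: heq_tens_id (heq_eqhom _) (heq_refl _).
apply: heq_idr; last exact: heq_sym23_unit_in.
exact: heq_tens_id (heq_eqhom _) (heq_eqhom _).
Qed.

Lemma tens_comodule (X : bimonoid C) (V V' : C)
    (r : hom V (bim_com X ⊗ V)) (r' : hom V' (bim_com X ⊗ V')) :
  is_comodule r -> is_comodule r' ->
  @is_comodule (bim_com X) _ (@tens_coact (bim_mon X) V V' r r').
Proof.
have [deltaM _] := bim_deltaP X; have [epsM _] := bim_epsP X.
move=> [rD rE] [r'D r'E]; split.
- exact: tens_coact_coassoc deltaM rD r'D.
- exact: tens_coact_counit epsM rE r'E.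
Qed.

Lemma unit_coact_coassoc (X : C) (u : hom (munit C) X)
    (R := (u ⊠ idm (munit C)) · unlunit (munit C)) :
  (((u ⊠ u) · unlunit (munit C)) ⊠ idm (munit C)) · unlunit (munit C)
  = unassoc X X (munit C) · (idm X ⊠ R) · R.
Proof.
rewrite /R tensm_compr tensm_compl -!compA (compA (idm X ⊠ unlunit _)).
rewrite -tensm_rl [u ⊠ unlunit _]tensm_lr -(compA (u ⊠ _)).
rewrite (compA (idm X ⊠ (u ⊠ _))) -tensm_comp comp_idl comp_idr.
rewrite (compA (unassoc _ _ _)) -unassoc_nat -compA; congr (_ · _).
rewrite /unlunit /unassoc eqhom_tensl eqhom_tensr !eqhom_trans.
exact: eqhom_irr.
Qed.

Lemma heq_tens_coactA (X : bimonoid C) (V V' V'' : C)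
    (r : hom V (bim_mon X ⊗ V)) (r' : hom V' (bim_mon X ⊗ V'))
    (r'' : hom V'' (bim_mon X ⊗ V'')) :
  tens_coact (tens_coact r r') r'' ≡ tens_coact r (tens_coact r' r'').
Proof.
have mA := muA (bim_monP X); rewrite /tens_coact.
move: (mu _) mA r r' r''; rewrite /=; move: (bim_obj X) => Y m mA r r' r''.
rewrite -[r'' in X in X ≡ _]comp_idl -[r in X in _ ≡ X]comp_idl.
rewrite !tensm_comp.
rewrite (compA (sym23 Y (V ⊗ V') Y V'')) -[idm (Y ⊗ V'')]tensm_id sym23_natl.
rewrite (compA (sym23 Y V Y (V' ⊗ V''))) -[idm (Y ⊗ V)]tensm_id sym23_natl.
rewrite 2!(compA (m ⊠ _)) -!tensm_comp mA !comp_idl.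
rewrite -(compA (idm Y ⊠ m ⊠ _)) (compA (m ⊠ _)) -tensm_compl -compA.
apply: heq_comp.
  apply: heq_tens; first exact/heq_eqhomr/heq_refl.
  exact/heq_idm/(tens0A (moncat_laws C)).
rewrite -[r'' in X in X ≡ _]comp_idl -[r in X in _ ≡ X]comp_idl !tensm_comp.
rewrite (compA (sym23 _ _ _ _)) (compA (sym23 Y V _ _)).
exact: heq_comp (sym23_assoc_out _ _ _ _ _ _) (heq_tensA _ _ _).
Qed.

Lemma heq_tens_coact_unitl (X : bimonoid C) (V : C)
    (r : hom V (bim_mon X ⊗ V)) :
  tens_coact (unit_coact (bim_mon X)) r ≡ r.
Proof.
have m1 := mu_etal (bim_monP X); rewrite /tens_coact /unit_coact.
move: (mu _) (eta _) m1 r; rewrite /=; move: (bim_obj X) => Y m u m1 r.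
rewrite -[r in X in X ≡ _]comp_idl tensm_comp (compA (sym23 _ _ _ _)).
rewrite -[idm (Y ⊗ V)]tensm_id sym23_natl 2!(compA (m ⊠ _)) -tensm_comp m1.
rewrite comp_idl -compA; apply: heq_idl.
  exact: heq_tens_id (heq_eqhom _) (heq_refl _).
apply: heq_idl; first exact: heq_sym23_unitl.
apply: heq_trans (heq_unitl r); apply: heq_tens (heq_refl _).
exact: heq_eqhom_dom.
Qed.

Lemma heq_tens_coact_unitr (X : bimonoid C) (V : C)
    (r : hom V (bim_mon X ⊗ V)) :
  tens_coact r (unit_coact (bim_mon X)) ≡ r.
Proof.
have m1 := mu_etar (bim_monP X); rewrite /tens_coact /unit_coact.
move: (mu _) (eta _) m1 r; rewrite /=; move: (bim_obj X) => Y m u m1 r.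
rewrite -[r in X in X ≡ _]comp_idl tensm_comp (compA (sym23 _ _ _ _)).
rewrite -[idm (Y ⊗ V)]tensm_id sym23_natl 2!(compA (m ⊠ _)) -tensm_comp m1.
rewrite comp_idl -compA; apply: heq_idl.
  exact: heq_tens_id (heq_eqhom _) (heq_refl _).
apply: heq_idl; first exact: heq_sym23_unitr.
apply: heq_trans (heq_unitr r); apply: heq_tens (heq_refl _) _.
exact: heq_eqhom_dom.
Qed.

Lemma tens_coact_mor (X : monoid_data C) (V V' W W' : C)
    (r : hom V (X ⊗ V)) (r' : hom V' (X ⊗ V'))
    (q : hom W (X ⊗ W)) (q' : hom W' (X ⊗ W')) (f : hom V W) (f' : hom V' W') :
  q · f = (idm X ⊠ f) · r -> q' · f' = (idm X ⊠ f') · r' ->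
  tens_coact q q' · (f ⊠ f') = (idm X ⊠ (f ⊠ f')) · tens_coact r r'.
Proof.
move=> qf qf'; rewrite /tens_coact -(compA (mu X ⊠ _)).
rewrite -(compA (sym23 _ _ _ _)) -tensm_comp qf qf' tensm_comp.
rewrite (compA (sym23 _ _ _ _)) sym23_natr -(compA (idm _ ⊠ _)).
rewrite (compA (mu X ⊠ _)) (compA (idm X ⊠ _)); congr (_ · _).
by rewrite -!tensm_comp !comp_idl !comp_idr.
Qed.

Lemma tens_coact_sym (X : monoid_data C) (V V' : C)
    (r : hom V (X ⊗ V)) (r' : hom V' (X ⊗ V')) :
  mu X · sym X X = mu X ->
  tens_coact r' r · sym V V' = (idm X ⊠ sym V V') · tens_coact r r'.
Proof.
move=> muC; rewrite /tens_coact -(compA (mu X ⊠ _)).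
rewrite -(compA (sym23 _ _ _ _)) -(sym_nat (symP C)).
rewrite (compA (sym23 _ _ _ _)) sym23_sym -(compA (sym X X ⊠ _)).
rewrite (compA (mu X ⊠ _)) (compA (idm X ⊠ _)); congr (_ · _).
by rewrite -!tensm_comp muC !comp_idl !comp_idr.
Qed.

Lemma unit_comodule (X : bimonoid C) :
  @is_comodule (bim_com X) _ (unit_coact (bim_mon X)).
Proof.
have [_ deltaU] := bim_deltaP X; have [_ epsU] := bim_epsP X.
split; rewrite /unit_coact compA -tensm_compl /=.
- by rewrite deltaU; apply: unit_coact_coassoc.
- by rewrite epsU tensm_id comp_idl.
Qed.

End Symmetric.

(** * Corepresentations as comodules *)

Section Comodules.

Variables (C : symmoncat) (P : full_monsub C) (H : coclosed P).

(** Corepresentations of [X] on [V] correspond to comodule structures. *)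
Lemma comonoid_mor_comodule (X : comonoid_data C) (V : subobj P)
    (w : hom (coend H V) X) :
  is_comonoid_mor w <-> is_comodule (@theta C P H V V X w).
Proof.
have wD : @theta C P H V V _ ((w ⊠ w) · delta (coend H V)) =
    unassoc X X V · (idm X ⊠ @theta C P H V V X w) · @theta C P H V V X w.
  rewrite theta_tens_delta [w ⊠ _]tensm_rl -!compA.
  by do 2 congr (_ · _); rewrite thetaE.
split.
- move=> [eD eE]; split.
    by rewrite -theta_comp eD wD.
  by rewrite -theta_comp eE theta_coend_eps.
- move=> [eD eE]; split; apply: (@theta_inj C P H V V).
    by rewrite theta_comp eD wD.
  by rewrite theta_comp eE theta_coend_eps.
Qed.

Variable X : bimonoid C.

(** The coaction corresponding to a corepresentation under [theta]. *)
Definition coaction (a : corep H X) : hom a (bim_obj X ⊗ a) :=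
  @theta C P H a a _ (corep_mor a).

Lemma theta_corep_tens_mor (a b : corep H X) :
  @theta C P H (sub_tens a b) (sub_tens a b) _ (corep_tens_mor a b)
  = @tens_coact C (bim_mon X) a b (coaction a) (coaction b).
Proof.
rewrite /corep_tens_mor -compA !theta_comp /tens_coact; congr (_ · _).
rewrite /kappa theta_invK compA /= -tensm_id -sym23_nat -compA -tensm_comp.
by rewrite /coaction !thetaE.
Qed.

Lemma theta_corep_unit_mor :
  @theta C P H (sub_unit P) (sub_unit P) _ (corep_unit_mor H X)
  = unit_coact (bim_mon X).
Proof. by rewrite /corep_unit_mor theta_comp theta_coend_eps. Qed.

Lemma corep_mor_coaction (a b : corep H X) (f : @hom C a b) :
  is_corep_mor f <-> coaction b · f = (idm (bim_obj X) ⊠ f) · coaction a.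
Proof.
have El := theta_nat f (idm (sub_val a)) (idm (bim_obj X)) (corep_mor a).
have Er := theta_nat (idm (sub_val b)) f (idm (bim_obj X)) (corep_mor b).
rewrite comp_idl comp_idr in El; rewrite comp_idl tensm_id comp_idl in Er.
rewrite /is_corep_mor /coaction; split=> [E|E].
  by rewrite -El -Er; congr theta; rewrite [RHS]E.
by apply: (@theta_inj C P H b a); rewrite [LHS]El [RHS]Er.
Qed.

(** A corepresentation is determined by its underlying object and its
    coaction. *)
Lemma corep_ext (a b : corep H X) :
  sub_val a = sub_val b -> coaction a ≡ coaction b -> a = b.
Proof.
case: a => [[V VP] w wP]; case: b => [[W WP] z zP] /= e.
case: W / e WP z zP => WP; rewrite (proof_irrelevance _ WP VP) => z zP.
rewrite /coaction /= => /heq_eq wz.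
have {}wz : w = z by apply: (@theta_inj C P H (SubObj VP) (SubObj VP)).
case: z / wz zP => zP; by rewrite (proof_irrelevance _ wP zP).
Qed.

(** * The monoidal category of corepresentations *)

Lemma corep_comodule (a : corep H X) :
  @is_comodule C (bim_com X) a (coaction a).
Proof. exact: (proj1 (comonoid_mor_comodule _) (corep_morP a)). Qed.

Lemma corep_tensP (a b : corep H X) : is_comonoid_mor (corep_tens_mor a b).
Proof.
apply/comonoid_mor_comodule; rewrite [theta _]theta_corep_tens_mor.
exact: tens_comodule (corep_comodule a) (corep_comodule b).
Qed.

Lemma corep_unitP : is_comonoid_mor (corep_unit_mor H X).
Proof.
apply/comonoid_mor_comodule; rewrite [theta _]theta_corep_unit_mor.
exact: unit_comodule.
Qed.

Lemma coaction_tens (a b : corep H X) :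
  coaction (corep_tens corep_tensP a b)
  = @tens_coact C (bim_mon X) a b (coaction a) (coaction b).
Proof. exact: theta_corep_tens_mor. Qed.

Lemma corep_tensmP (a b a' b' : corep H X) (f : corep_hom a b)
    (f' : corep_hom a' b') :
  @is_corep_mor C P H X
    (corep_tens corep_tensP a a') (corep_tens corep_tensP b b') (f ⊠ f').
Proof.
apply/corep_mor_coaction; rewrite !coaction_tens.
by apply: (@tens_coact_mor C (bim_mon X)); apply/corep_mor_coaction/corep_homP.
Qed.

Lemma corep_hom_eqhom (a b : corep H X) (e : a = b) :
  corep_hom_val (@eqhom (Corep_cat H X) a b e)
  = eqhom (f_equal (fun c : corep H X => sub_val c) e).
Proof. by case: b / e. Qed.

Lemma corep_monP :
  is_strict_monoidal (corep_monoidal_data corep_tensP corep_unitP corep_tensmP).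
Proof.
unshelve econstructor.
- move=> a b d; apply: corep_ext; first exact: tens0A (moncat_laws C) _ _ _.
  rewrite !coaction_tens; exact: heq_tens_coactA.
- move=> a; apply: corep_ext; first exact: tens0_unitl (moncat_laws C) _.
  rewrite coaction_tens /coaction /= theta_corep_unit_mor.
  exact: heq_tens_coact_unitl.
- move=> a; apply: corep_ext; first exact: tens0_unitr (moncat_laws C) _.
  rewrite coaction_tens /coaction /= theta_corep_unit_mor.
  exact: heq_tens_coact_unitr.
- by move=> a b; apply/corep_hom_eq/tensm_id.
- by move=> a b d a' b' d' f g f' g'; apply/corep_hom_eq/tensm_comp.
- move=> a b d a' b' d' f g h; apply/corep_hom_eq.
  rewrite /= !corep_hom_eqhom; apply: heq_eq; apply: heq_eqhoml.
  apply/heq_sym/heq_eqhomr/heq_sym; exact: heq_tensA.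
- move=> a a' f; apply/corep_hom_eq.
  rewrite /= !corep_hom_eqhom; apply: heq_eq; apply: heq_eqhoml.
  apply/heq_sym/heq_eqhomr/heq_sym; exact: heq_unitl.
- move=> a a' f; apply/corep_hom_eq.
  rewrite /= !corep_hom_eqhom; apply: heq_eq; apply: heq_eqhoml.
  apply/heq_sym/heq_eqhomr/heq_sym; exact: heq_unitr.
Qed.

Lemma corep_symP (a b : corep H X) : commutative X ->
  @is_corep_mor C P H X
    (corep_tens corep_tensP a b) (corep_tens corep_tensP b a)
    (sym (sub_val a) (sub_val b)).
Proof.
move=> XC; apply/corep_mor_coaction; rewrite !coaction_tens.
exact: (@tens_coact_sym C (bim_mon X)).
Qed.

Lemma corep_symmetry (XC : commutative X) :
  is_symmetry (corep_sym corep_monP (fun a b => corep_symP a b XC)).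
Proof.
split.
- by move=> a b a' b' f f'; apply/corep_hom_eq/(sym_nat (symP C)).
- by move=> a b; apply/corep_hom_eq/(sym_invol (symP C)).
- move=> a b d; apply/corep_hom_eq; rewrite /= !corep_hom_eqhom.
  (* The transports of [Corep_cat] and of [C] along associativity have the
     same underlying morphism, by proof irrelevance. *)
  have := sym_hexagon (symP C) (sub_val a) (sub_val b) (sub_val d).
  rewrite /assoc => E.
  by etransitivity; [etransitivity; last exact: E|]; congr (_ · _);
     try congr (_ · _); exact: eqhom_irr.
Qed.

End Comodules.
End CorepMonoidal.

Theorem theorem3p20 (C : symmoncat) (P : full_monsub C) (H : coclosed P)
    (X : bimonoid C) :
  exists (tensP : forall a b : corep H X,
            is_comonoid_mor (corep_tens_mor a b))
         (unitP : is_comonoid_mor (corep_unit_mor H X))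
         (tensmP : forall (a b a' b' : corep H X) (f : corep_hom a b)
                     (f' : corep_hom a' b'),
            @is_corep_mor C P H X
              (corep_tens tensP a a') (corep_tens tensP b b') (f ⊠ f'))
         (monP : is_strict_monoidal
                   (corep_monoidal_data tensP unitP tensmP)),
    commutative X ->
    exists symP : forall a b : corep H X,
        @is_corep_mor C P H X
          (corep_tens tensP a b) (corep_tens tensP b a)
          (sym (sub_val a) (sub_val b)),
      is_symmetry (corep_sym monP symP).
Proof.
exists (@corep_tensP C P H X), (corep_unitP H X), (@corep_tensmP C P H X).
exists (corep_monP H X) => XC.
by exists (fun a b => corep_symP a b XC); apply: corep_symmetry.
Qed.
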